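(* Let $M\ge 1$ and $J_1,\dots,J_M\ge 1$ be integers, and for each $k=1,\dots,M$ let $A^{(k)}\in\mathbb{R}^{J_k\times J_k}$ be symmetric and positive definite, with maximum and minimum eigenvalues $\lambda_{\max}^{(k)}$ and $\lambda_{\min}^{(k)}$ respectively. Let $$A=\sum_{k=1}^{M} I_{J_M}\otimes\cdots\otimes I_{J_{k+1}}\otimes A^{(k)}\otimes I_{J_{k-1}}\otimes\cdots\otimes I_{J_1}\in\mathbb{R}^{(J_1J_2\cdots J_M)\times(J_1J_2\cdots J_M)}.$$ Then $A$ is symmetric and positive definite, and its maximum and minimum eigenvalues are $\lambda_{\max}=\sum_{k=1}^{M}\lambda_{\max}^{(k)}$ and $\lambda_{\min}=\sum_{k=1}^{M}\lambda_{\min}^{(k)}$ respectively. Moreover, let $\mathcal{D}\in\mathbb{R}^{J_1\times\cdots\times J_M}$, let $\mathcal{X}^*$ be the solution of the Sylvester tensor equation $\mathcal{X}\times_1A^{(1)}+\mathcal{X}\times_2A^{(2)}+\cdots+\mathcal{X}\times_MA^{(M)}=\mathcal{D}$, and let $\mathcal{X}^0\in\mathbb{R}^{J_1\times\cdots\times J_M}$ be an initial guess with $\mathcal{X}^0\neq\mathcal{X}^*$. Then for every number $m_l$ of iterations, the approximate solution $\mathcal{X}^{m_l}$ produced from $\mathcal{X}^0$ by $m_l$ steps of the tensor-form conjugate gradient method (CG_BTF) satisfies $$\frac{\|\mathcal{X}^{m_l}-\mathcal{X}^*\|_{\mathcal{M}}^{2}}{\|\mathcal{X}^{0}-\mathcal{X}^*\|_{\mathcal{M}}^{2}}\le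 2\left(\frac{\sqrt{\kappa(A)}-1}{\sqrt{\kappa(A)}+1}\right)^{m_l},$$ where $\kappa(A)=\lambda_{\max}/\lambda_{\min}$ is the spectral condition number of $A$.
   Context: $I_J$ is the $J\times J$ identity matrix and $\otimes$ is the Kronecker product (the block matrix $A\otimes B$ has blocks $a_{ij}B$). For $\mathcal{X}\in\mathbb{R}^{J_1\times\cdots\times J_M}$ and $B=(b_{ji})\in\mathbb{R}^{J\times J_k}$, the mode-$k$ product $\mathcal{X}\times_kB$ is the tensor of size $J_1\times\cdots\times J_{k-1}\times J\times J_{k+1}\times\cdots\times J_M$ with entries $$(\mathcal{X}\times_kB)_{i_1\cdots i_{k-1}\,j\,i_{k+1}\cdots i_M}=\sum_{i_k=1}^{J_k}x_{i_1\cdots i_M}\,b_{j i_k}.$$ The inner product of tensors is $\langle\mathcal{X},\mathcal{Y}\rangle=\sum_{i_1,\dots,i_M}x_{i_1\cdots i_M}y_{i_1\cdots i_M}$. The linear operator $\mathcal{M}:\mathbb{R}^{J_1\times\cdots\times J_M}\to\mathbb{R}^{J_1\times\cdots\times J_M}$ is $\mathcal{M}(\mathcal{X})=\mathcal{X}\times_1A^{(1)}+\cdots+\mathcal{X}\times_MA^{(M)}$. Set $\langle\mathcal{X},\mathcal{Y}\rangle_{\mathcal{M}}=\langle\mathcal{M}(\mathcal{X}),\mathcal{Y}\rangle$ and $\|\mathcal{X}\|_{\mathcal{M}}=\langle\mathcal{X},\mathcal{X}\rangle_{\mathcal{M}}^{1/2}$. CG_BTF (conjugate gradient method based on tensor form)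 is the conjugate gradient iteration for $\mathcal{M}(\mathcal{X})=\mathcal{D}$ with respect to $\langle\cdot,\cdot\rangle$: put $\mathcal{R}_0=\mathcal{D}-\mathcal{M}(\mathcal{X}^0)$, $\mathcal{P}_0=\mathcal{R}_0$, and for $j=0,1,2,\dots$, as long as $\mathcal{R}_j\ne0$, $$\alpha_j=\frac{\langle\mathcal{R}_j,\mathcal{R}_j\rangle}{\langle\mathcal{M}(\mathcal{P}_j),\mathcal{P}_j\rangle},\quad \mathcal{X}^{j+1}=\mathcal{X}^j+\alpha_j\mathcal{P}_j,\quad \mathcal{R}_{j+1}=\mathcal{R}_j-\alpha_j\mathcal{M}(\mathcal{P}_j),$$ $$\beta_j=\frac{\langle\mathcal{R}_{j+1},\mathcal{R}_{j+1}\rangle}{\langle\mathcal{R}_j,\mathcal{R}_j\rangle},\quad \mathcal{P}_{j+1}=\mathcal{R}_{j+1}+\beta_j\mathcal{P}_j.$$ If $\mathcal{R}_j=0$, the iteration stops and all later iterates are taken equal to $\mathcal{X}^j=\mathcal{X}^*$. *)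

(* Defs.v *)
From HB Require Import structures.
From mathcomp Require Import all_boot all_order all_algebra reals.
From mathcomp Require Export mxtens.

Set Implicit Arguments.
Unset Strict Implicit.
Unset Printing Implicit Defensive.

Import Order.TTheory GRing.Theory Num.Theory.
Local Open Scope ring_scope.

Section Matrices.
Variable R : realType.

Definition posdefmx n (A : 'M[R]_n) : Prop :=
  forall x : 'cV[R]_n, x != 0 -> 0 < (x^T *m A *m x) 0 0.

(* `eigenvalue` is about row vectors; a square matrix and its transpose have
   the same eigenvalues. *)
Definition is_max_eigenvalue n (A : 'M[R]_n) (a : R) : Prop :=
  eigenvalue A a /\ forall b : R, eigenvalue A b -> b <= a.

Definition is_min_eigenvalue n (A : 'M[R]_n) (a : R) : Prop :=
  eigenvalue A a /\ forall b : R, eigenvalue A b -> a <= b.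

(* The modes 1, ..., M are the elements 0, ..., M - 1 of 'I_M. *)
Fixpoint kron_dim M : ('I_M -> nat) -> nat :=
  match M with
  | 0 => fun=> 1%N
  | M'.+1 => fun J =>
      (J ord_max * kron_dim (fun k => J (widen_ord (leqnSn M') k)))%N
  end.

Lemma kron_dimE M (J : 'I_M -> nat) : kron_dim J = (\prod_(k < M) J k)%N.
Proof.
elim: M J => [|M IHM] J /=; first by rewrite big_ord0.
by rewrite IHM big_ord_recr /= mulnC.
Qed.

(* B_(M-1) (x) ... (x) B_0, in decreasing order of modes; the empty product is
   the 1 x 1 identity matrix. *)
Fixpoint kron_prod M :
    forall J : 'I_M -> nat, (forall k, 'M[R]_(J k)) -> 'M[R]_(kron_dim J) :=
  match M with
  | 0 => fun _ _ => 1%:M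
  | M'.+1 => fun J B =>
      B ord_max *t kron_prod (fun k => B (widen_ord (leqnSn M') k))
  end.

Definition kron_sum M (J : 'I_M -> nat) (A : forall k, 'M[R]_(J k)) :
    'M[R]_(kron_dim J) :=
  \sum_(k < M) kron_prod (dfwith (fun j => 1%:M : 'M[R]_(J j)) (A k)).

End Matrices.

Section Tensors.
Variables (R : realType) (M : nat) (J : 'I_M -> nat).

Definition multi_index := {dffun forall k : 'I_M, 'I_(J k)}.

Definition tensor := {ffun multi_index -> R^o}.

(* The mode-k product for a square B, which leaves the size unchanged. *)
Definition mode_prod (X : tensor) (k : 'I_M) (B : 'M[R]_(J k)) : tensor :=
  [ffun i : multi_index =>
     \sum_(l < J k) (X (finfun (dfwith i l) : multi_index) : R) * B (i k) l].

Definition inner (X Y : tensor) : R :=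
  \sum_(i : multi_index) (X i : R) * (Y i : R).

Variable A : forall k, 'M[R]_(J k).

Definition sylvester_op (X : tensor) : tensor :=
  \sum_(k < M) mode_prod X (A k).

Definition op_inner (X Y : tensor) : R := inner (sylvester_op X) Y.

Definition op_norm (X : tensor) : R := Num.sqrt (op_inner X X).

Record cg_state := CGState {
  cg_iterate : tensor;
  cg_residual : tensor;
  cg_direction : tensor }.

Definition cg_init (D X0 : tensor) : cg_state :=
  let R0 := D - sylvester_op X0 in CGState X0 R0 R0.

Definition cg_step (s : cg_state) : cg_state :=
  let: CGState X r P := s in
  if r == 0 then s else
  let alpha := inner r r / inner (sylvester_op P) P in
  let r' := r - alpha *: sylvester_op P in
  let beta := inner r' r' / inner r r in
  CGState (X + alpha *: P) r' (r' + beta *: P).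

Definition cg_btf (D X0 : tensor) (m : nat) : tensor :=
  cg_iterate (iter m cg_step (cg_init D X0)).

End Tensors.

(* Main.v *)
(* Every A^(k) is diagonalised by the spectral theorem over R[i], so its extreme
   eigenvalues are the optimal constants in lambda_min |x|^2 <= x^T A x <=
   lambda_max |x|^2.  These bounds add up over the modes, both for the Kronecker
   sum and for the Sylvester operator, and tensor products of eigenvectors show
   that they are attained.

   For the conjugate gradient bound, let L be the operator, a <= L <= b,
   c = (a + b) / 2, d = (b - a) / 2, N = c - L and G = d^2 - N^2 = (L - a)(b - L).
   The coupled recursion t' = N t - G u, u' = N u + t started at (e_0, 0) yields
   t_m = d^m T_m(N / d) e_0, and [t, t] + [G u, u] is multiplied by d^2 at every
   step for [x, y] = <L x, y>; as G is nonnegative this gives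
   [t_m, t_m] <= d^(2m) [e_0, e_0] without any spectral decomposition of L (and
   without dividing by d, which may be 0).  The same recursion on scalars, with N
   replaced by c, gives tau_m = ((c + s)^m + (c - s)^m) / 2 where s^2 = a b, and
   t_m - tau_m e_0 lies in the span of the first m search directions.  Optimality
   of the conjugate gradient iterate then gives
   tau_m^2 [e_m, e_m] <= d^(2m) [e_0, e_0]. *)

From HB Require Import structures.
Require Import Defs.
From mathcomp Require Import all_boot all_order all_algebra reals.
From mathcomp Require Import spectral complex ring lra.

Set Implicit Arguments.
Unset Strict Implicit.
Unset Printing Implicit Defensive.

Import Order.TTheory GRing.Theory Num.Theory VectorInternalTheory.
Local Open Scope ring_scope.

(** * Coordinates of vectors in a finite-dimensional space *)

Section VectorCoordinates.
Variables (R : nzRingType) (V : vectType R).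

Lemma v2r_entryD (x y : V) i : v2r (x + y) 0 i = v2r x 0 i + v2r y 0 i.
Proof. by rewrite linearD mxE. Qed.

Lemma v2r_entryN (x : V) i : v2r (- x) 0 i = - v2r x 0 i.
Proof. by rewrite linearN mxE. Qed.

Lemma v2r_entryZ k (x : V) i : v2r (k *: x) 0 i = k * v2r x 0 i.
Proof. by rewrite linearZ mxE. Qed.

Lemma v2r_entry0 i : v2r (0 : V) 0 i = 0.
Proof. by rewrite linear0 mxE. Qed.

End VectorCoordinates.

(* Linear identities between vectors are field identities between coordinates. *)
Ltac vector_field :=
  apply: (can_inj (@v2rK _ _)); apply/rowP => ?;
  rewrite !(v2r_entryD, v2r_entryN, v2r_entryZ, v2r_entry0); by field.

(** * The Chebyshev recursion, its scalar values and its energy *)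

(* For G = d^2 - N^2 these are d^m T_m(N / d) e and d^(m - 1) U_(m-1)(N / d) e,
   with T and U the Chebyshev polynomials of the two kinds. *)
Definition chebyshev (V : zmodType) (N G : V -> V) (e : V) (m : nat) : V * V :=
  iter m (fun tu => (N tu.1 - G tu.2, N tu.2 + tu.1)) (e, 0).

Lemma chebyshevS (V : zmodType) (N G : V -> V) (e : V) (m : nat) :
  let tu := chebyshev N G e m in
  chebyshev N G e m.+1 = (N tu.1 - G tu.2, N tu.2 + tu.1).
Proof. by []. Qed.

(** Here [G] is multiplication by [d ^+ 2 - c ^+ 2 = - s ^+ 2], so each step multiplies [t + s * u]
    by [c + s]. The sign of [s] is free; the two signs together determine [t]. *)
Lemma chebyshev_scalar (R : comNzRingType) (c d s : R) (m : nat) :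
    c ^+ 2 - s ^+ 2 = d ^+ 2 ->
  let tu := chebyshev ( *%R c) (fun y => d ^+ 2 * y - c * (c * y)) 1 m in
  tu.1 + s * tu.2 = (c + s) ^+ m.
Proof.
move=> <-; elim: m => [|m] /=; first by rewrite mulr0 addr0.
case: (chebyshev _ _ _ m) => t u /= IHm.
by rewrite [(c + s) ^+ _]exprS -IHm; ring.
Qed.

(** Operator form of the Pell identity for Chebyshev polynomials: [N] and [G] commute and are
    self-adjoint for [B], so the cross terms cancel, and the sum of [G] and the square of [N] is
    [d ^+ 2]. *)
Lemma chebyshev_energy (R : comNzRingType) (V : lmodType R) (B : V -> V -> R)
    (N : V -> V) (d : R) (e : V) (m : nat) :
    {morph N : x y / x + y} -> (forall k, {morph N : x / k *: x}) ->
    (forall x y, B x y = B y x) ->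
    (forall x y z, B (x + y) z = B x z + B y z) ->
    (forall k x y, B (k *: x) y = k * B x y) ->
    (forall x y, B (N x) y = B x (N y)) ->
  let G x := d ^+ 2 *: x - N (N x) in
  let tu := chebyshev N G e m in
  B tu.1 tu.1 + B (G tu.2) tu.2 = d ^+ (m + m) * B e e.
Proof.
move=> ND NZ BC BDl BZl NC G.
have NN : {morph N : x / - x} by move=> x; rewrite -scaleN1r NZ scaleN1r.
have N0 : N 0 = 0 by have := NZ 0 0; rewrite !scale0r.
have BNl x y : B (- x) y = - B x y by rewrite -scaleN1r BZl mulN1r.
have BDr x y z : B x (y + z) = B x y + B x z by rewrite ![B x _]BC BDl.
have BZr k x y : B x (k *: y) = k * B x y by rewrite ![B x _]BC BZl.
have BNr x y : B x (- y) = - B x y by rewrite ![B x _]BC BNl.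
have B0 x : B 0 x = 0 by rewrite -(scale0r 0) BZl mul0r.
have BE := (BDl, BDr, BNl, BNr, BZl, BZr).
elim: m => [|m]; first by rewrite /= /G !N0 scaler0 subrr B0 addr0 mul1r.
rewrite chebyshevS; case: (chebyshev _ _ _ m) => t u /= IHm.
rewrite addnS addSn !exprS !mulrA -expr2 -mulrA -IHm /G.
by rewrite !(NN, ND, NZ) !BE !NC; ring.
Qed.

(** Used with [Q = q ^+ m] and [g = (c + s) ^+ m], where [q] is the convergence factor. Then
    [T = g * (1 + Q ^+ 2) / 2], and [2 * Q <= (1 + Q ^+ 2) ^+ 2] gives a bound linear in [Q]. *)
Lemma chebyshev_ratio (R : realFieldType) (T v Q g Em E0 : R) :
    0 <= Em -> 0 <= E0 -> 0 <= Q -> Q <= 1 -> 0 < g ->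
    T - v = Q * Q * g -> T + v = g -> T ^+ 2 * Em <= Q * g * (Q * g) * E0 ->
  Em <= 2 * Q * E0.
Proof.
move=> Em_ge0 E0_ge0 Q_ge0 Q_le1 g_gt0 Tmv Tpv.
have -> : T = g * ((1 + Q ^+ 2) / 2) by lra.
have -> : Q * g * (Q * g) * E0 = g ^+ 2 * (Q ^+ 2 * E0) by ring.
have -> : (g * ((1 + Q ^+ 2) / 2)) ^+ 2 * Em =
    g ^+ 2 * (((1 + Q ^+ 2) / 2) ^+ 2 * Em) by ring.
rewrite ler_pM2l ?exprn_gt0 // => main.
have step : 2 * Q * Em <= 4 * Q ^+ 2 * E0.
  apply: (@le_trans _ _ ((1 + Q ^+ 2) ^+ 2 * Em)); last by move: main; lra.
  rewrite ler_wpM2r //; nra.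
(* The factor [2 * Q] cannot be cancelled at [Q = 0], where [main] already forces [Em <= 0]. *)
have [Q0|Q_gt0] := leP Q 0; last first.
  rewrite -(ler_pM2l (_ : 0 < 2 * Q)) ?mulr_gt0 //.
  by rewrite (le_trans step) // le_eqVlt; apply/predU1P; left; ring.
have Q00 : Q = 0 by apply/le_anti; rewrite Q0.
by move: main; rewrite Q00; lra.
Qed.

Section SelfAdjoint.
Variables (R : realFieldType) (V : vectType R) (ip : V -> V -> R).
Hypothesis ipC : forall x y, ip x y = ip y x.
Hypothesis ipDl : forall x y z, ip (x + y) z = ip x z + ip y z.
Hypothesis ipZl : forall c x y, ip (c *: x) y = c * ip x y.
Hypothesis ip_gt0 : forall x, x != 0 -> 0 < ip x x.
Variables (L : {linear V -> V}) (a b : R).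
Hypothesis LC : forall x y, ip (L x) y = ip x (L y).
Hypothesis a_gt0 : 0 < a.
Hypothesis le_ab : a <= b.
Hypothesis L_ge : forall x, a * ip x x <= ip (L x) x.
Hypothesis L_le : forall x, ip (L x) x <= b * ip x x.

Let ipNl x y : ip (- x) y = - ip x y.
Proof. by rewrite -scaleN1r ipZl mulN1r. Qed.

Let ipDr x y z : ip x (y + z) = ip x y + ip x z.
Proof. by rewrite ![ip x _]ipC ipDl. Qed.

Let ipZr c x y : ip x (c *: y) = c * ip x y.
Proof. by rewrite ![ip x _]ipC ipZl. Qed.

Let ipNr x y : ip x (- y) = - ip x y.
Proof. by rewrite ![ip x _]ipC ipNl. Qed.

Let ipE := (ipDl, ipDr, ipNl, ipNr, ipZl, ipZr).

Let ip_ge0 x : 0 <= ip x x.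
Proof.
have [->|/ip_gt0/ltW//] := eqVneq x 0.
by rewrite -(scale0r 0) ipZl mul0r.
Qed.

Let L_gt0 x : x != 0 -> 0 < ip (L x) x.
Proof. by move=> /ip_gt0 x_gt0; rewrite (lt_le_trans _ (L_ge x)) ?mulr_gt0. Qed.

Let c : R := (a + b) / 2.
Let d : R := (b - a) / 2.
Let N (x : V) : V := c *: x - L x.
Let G (x : V) : V := d ^+ 2 *: x - N (N x).

(* (L - a)(b - L) is a product of commuting nonnegative operators; instead of
   taking square roots, with P = L - a one uses <P y, y> >= 0 at
   y = (b - a) z - P z. *)
Lemma gap_form_ge0 z : 0 <= ip (b *: (L z - a *: z) - L (L z - a *: z)) z.
Proof.
have [P PE] : exists P, forall x, P x = L x - a *: x by eexists.
rewrite -PE.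
have P_ge0 x : 0 <= ip (P x) x by rewrite !PE !ipE subr_ge0.
have P_le x : ip (P x) x <= (b - a) * ip x x.
  by rewrite !PE !ipE mulrBl lerB.
have PC x y : ip (P x) y = ip x (P y) by rewrite !PE !ipE LC.
have PB x y s : P (s *: x - y) = s *: P x - P y.
  by rewrite !PE linearB linearZ /=; vector_field.
have -> : ip (b *: P z - L (P z)) z = (b - a) * ip (P z) z - ip (P z) (P z).
  have LzE : L z = P z + a *: z by rewrite PE subrK.
  by rewrite ipDl ipNl ipZl LC LzE ipDr ipZr; ring.
rewrite subr_ge0; move: le_ab; rewrite le_eqVlt => /predU1P[eq_ab|lt_ab].
  (* For [a = b] the form of [P] vanishes identically, and the test vector [z - P z] gives
     [ip (P z) (P z) <= 0]. *)
  have Pz0 : ip (P z) z = 0.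
    by apply/le_anti; rewrite P_ge0 (le_trans (P_le z)) // eq_ab subrr mul0r.
  have := P_ge0 (1 *: z - P z); have := P_le (P z).
  rewrite PB !ipE [ip (P (P z)) z]PC Pz0 eq_ab subrr.
  by move: (ip (P (P z)) (P z)) (ip (P z) (P z)) => p q *; lra.
have ba_gt0 : 0 < b - a by rewrite subr_gt0.
rewrite -(ler_pM2l ba_gt0) -subr_ge0.
have := P_ge0 ((b - a) *: z - P z); have := P_le (P z).
rewrite PB !ipE [ip (P (P z)) z]PC.
move: (ip (P (P z)) (P z)) (ip (P z) (P z)) (ip (P z) z) => p q r.
by lra.
Qed.

(** With [P = L - a] one has [G = (b - L) P] and [L = a + P]. The form splits into [a * ip (G z) z],
    covered by [gap_form_ge0], and the form of [b - L] at [P z]. *)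
Lemma chebyshev_weight_ge0 z : 0 <= ip (L (G z)) z.
Proof.
have [P PE] : exists P, forall x, P x = L x - a *: x by eexists.
have GE : G z = b *: P z - L (P z).
  by rewrite /G /N !PE !(linearB, linearZ) /= /c /d; vector_field.
have -> : ip (L (G z)) z = a * ip (G z) z + ip (G z) (P z).
  by rewrite LC PE !ipE; ring.
rewrite addr_ge0 ?mulr_ge0 ?(ltW a_gt0) //; first by rewrite GE PE gap_form_ge0.
by rewrite GE !ipE subr_ge0.
Qed.

Variables (x r p : nat -> V) (xs : V).
Hypothesis r0E : r 0%N = L (xs - x 0%N).
Hypothesis p0E : p 0%N = r 0%N.
Let alpha j := ip (r j) (r j) / ip (L (p j)) (p j).
Let beta j := ip (r j.+1) (r j.+1) / ip (r j) (r j).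
Hypothesis xS : forall j, r j != 0 -> x j.+1 = x j + alpha j *: p j.
Hypothesis rS : forall j, r j != 0 -> r j.+1 = r j - alpha j *: L (p j).
Hypothesis pS : forall j, r j != 0 -> p j.+1 = r j.+1 + beta j *: p j.
Hypothesis x_stop : forall j, r j = 0 -> x j.+1 = x j.
Hypothesis r_stop : forall j, r j = 0 -> r j.+1 = 0.

Lemma cg_residual_error j : r j = L (xs - x j).
Proof.
elim: j => // j IHj; have [rj0|rj0] := eqVneq (r j) 0.
  by rewrite r_stop // x_stop // -IHj rj0.
by rewrite rS // xS // opprD addrA (linearB L) -IHj (linearZ_LR L).
Qed.

(** This span plays the part of the Krylov space of order [n]. *)
Let search n := (\sum_(j < n) <[p j]>)%VS.

Let searchS n : search n.+1 = (search n + <[p n]>)%VS.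
Proof. by rewrite /search big_ord_recr. Qed.

Let search_le n : (search n <= search n.+1)%VS.
Proof. by rewrite searchS addvSl. Qed.

Let mem_search n : p n \in search n.+1.
Proof. by rewrite searchS (subvP (addvSr _ _)) ?memv_line. Qed.

Let search_ortho n y :
  (forall w, w \in search n -> ip y w = 0) -> ip y (p n) = 0 ->
  forall w, w \in search n.+1 -> ip y w = 0.
Proof.
move=> y_n y_pn w; rewrite searchS => /memv_addP[u /y_n yu [_ /vlineP[k ->] ->]].
by rewrite ipDr ipZr yu y_pn mulr0 addr0.
Qed.

Let rS_neq0 n : r n.+1 != 0 -> r n != 0.
Proof. by apply: contraNneq => /r_stop ->. Qed.

(** The five facts need a joint induction: conjugacy at [n.+1] moves [L] onto [w], which stays in
    the next search space, where the new residual is orthogonal. *)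
Lemma cg_invariants n : r n != 0 ->
  [/\ r n \in search n.+1,
      forall w, w \in search n -> ip (r n) w = 0,
      forall w, w \in search n -> ip (L (p n)) w = 0,
      ip (r n) (p n) = ip (r n) (r n)
    & forall w, w \in search n -> L w \in search n.+1].
Proof.
elim: n => [|n IHn] rn0.
  have search0 w : w \in search 0 -> w = 0.
    by rewrite /search big_ord0 memv0 => /eqP.
  have ipx0 y : ip y 0 = 0 by rewrite -(scale0r 0) ipZr mul0r.
  split=> [|w /search0->|w /search0->||w /search0->] //.
  - by rewrite -p0E.
  - by rewrite p0E.
  - by rewrite linear0 mem0v.
have rn := rS_neq0 rn0.
have [r_in r_o p_o rpE L_in] := IHn rn.
have rr_gt0 : 0 < ip (r n) (r n) by rewrite ip_gt0.
have pn0 : p n != 0.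
  by apply: contraTneq rr_gt0 => pn0; rewrite -rpE pn0 -(scale0r 0) ipZr mul0r ltxx.
have lp_gt0 := L_gt0 pn0.
have al0 : alpha n != 0 by rewrite mulf_neq0 ?invr_eq0 ?gt_eqF.
have rS_in : r n.+1 \in search n.+2.
  rewrite -[r n.+1](addrK (beta n *: p n)) -pS // rpredB ?mem_search //.
  by rewrite memvZ // (subvP (search_le _)) ?mem_search.
(* Since [alpha n] is nonzero, [L (p n)] is a combination of two residuals; this is what keeps [L]
   inside the search spaces. *)
have LpE : L (p n) = (alpha n)^-1 *: (r n - r n.+1).
  by rewrite (rS rn) subKr scalerA mulVf ?scale1r.
have LS_in w : w \in search n.+1 -> L w \in search n.+2.
  rewrite searchS => /memv_addP[u /L_in Lu [_ /vlineP[k ->] ->]].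
  rewrite linearD linearZ /= LpE; apply: rpredD; first exact: (subvP (search_le _)).
  by rewrite !memvZ // rpredB // (subvP (search_le _)).
have rS_o : forall w, w \in search n.+1 -> ip (r n.+1) w = 0.
  apply: search_ortho => [w w_in|]; rewrite rS // !ipE.
    by rewrite r_o // p_o // mulr0 subr0.
  by rewrite rpE /alpha divfK ?subrr // gt_eqF.
have rSpE : ip (r n.+1) (p n.+1) = ip (r n.+1) (r n.+1).
  by rewrite pS // !ipE [ip _ (p n)]rS_o ?mulr0 ?addr0.
split=> //; apply: search_ortho => [w w_in|].
  rewrite pS // linearD linearZ /= !ipE p_o // mulr0 addr0 LC.
  by rewrite rS_o ?L_in.
(* Conjugacy to the latest direction [p n] is what the choice of [beta] achieves. *)
rewrite pS // linearD linearZ /= ipDl ipZl LC {1}LpE ipZr ipDr ipNr rS_o //.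
rewrite sub0r /alpha /beta.
by field; rewrite !gt_eqF.
Qed.

Lemma cg_error_in_search n : r n != 0 -> x 0%N - x n \in search n.
Proof.
elim: n => [|n IHn] rn; first by rewrite subrr mem0v.
have rn' := rS_neq0 rn.
rewrite xS // opprD addrA; apply: rpredB; last by rewrite memvZ ?mem_search.
by rewrite (subvP (search_le _)) ?IHn.
Qed.

Let e := xs - x 0%N.
(** The recursion at [L = 0], where [N] becomes [c]: these are the constant terms of the Chebyshev
    polynomials in [L]. *)
Let tau := chebyshev ( *%R c) (fun y => d ^+ 2 * y - c * (c * y)) 1.

(** Removing the constant term leaves a multiple of [L] applied to [e], and [L e] is the first
    direction. The degree of [u] is one less than that of [t], hence the smaller space. *)
Lemma chebyshev_in_search k : r k != 0 ->
  let tu := chebyshev N G e k.+1 in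
  tu.1 - (tau k.+1).1 *: e \in search k.+1 /\
  tu.2 - (tau k.+1).2 *: e \in search k.
Proof.
have Le n : L e \in search n.+1.
  elim: n => [|n]; last exact: (subvP (search_le _)).
  by rewrite -r0E -p0E mem_search.
have N_in n v s : r n != 0 -> v - s *: e \in search n ->
    N v - (c * s) *: e \in search n.+1.
  move=> rn v_in; have [_ _ _ _ L_in] := cg_invariants rn.
  have -> : N v - (c * s) *: e = c *: (v - s *: e) - L (v - s *: e) - s *: L e.
    by rewrite /N (linearB L) (linearZ_LR L) /=; vector_field.
  by rewrite !rpredB ?L_in ?(memvZ _ (Le _)) // memvZ // (subvP (search_le _)).
elim: k => [|k IHk] rk.
  rewrite /tau !chebyshevS /=; split; last first.
    have -> : N 0 + e - (c * 0 + 1) *: e = 0; last exact: mem0v.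
    by rewrite /N (linear0 L); vector_field.
  have -> : N e - G 0 - (c * 1 - (d ^+ 2 * 0 - c * (c * 0))) *: e = - L e.
    by rewrite /G /N !(linear0 L, scaler0, subr0); vector_field.
  by rewrite rpredN Le.
have rk' := rS_neq0 rk; have := IHk rk'.
rewrite [chebyshev N G e k.+2]chebyshevS.
have -> : tau k.+2 =
    (c * (tau k.+1).1 - (d ^+ 2 * (tau k.+1).2 - c * (c * (tau k.+1).2)),
     c * (tau k.+1).2 + (tau k.+1).1) by [].
case: (chebyshev N G e k.+1) (tau k.+1) => t u [t' u'] /= [t_in u_in].
have Nu_in := N_in _ _ _ rk' u_in.
split.
  (* [G u] applies [N] twice to [u], which starts one space lower than [t]; so it ends at most one
     space above [t], like [N t]. *)
  have -> : N t - G u - (c * t' - (d ^+ 2 * u' - c * (c * u'))) *: e =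
    (N t - (c * t') *: e) - d ^+ 2 *: (u - u' *: e)
     + (N (N u) - (c * (c * u')) *: e) by rewrite /G; vector_field.
  apply: rpredD; last exact: N_in.
  apply: rpredB; first exact: N_in.
  by apply: memvZ; rewrite (subvP (search_le _)) // (subvP (search_le _)).
have -> : N u + t - (c * u' + t') *: e = (N u - (c * u') *: e) + (t - t' *: e).
  by vector_field.
by rewrite rpredD.
Qed.

(** [f] stands for the square root of the condition number [b / a], so that [a * f] is the geometric
    mean of [a] and [b] and no root has to be taken in the field. *)
Lemma cg_error_le f m : 1 <= f -> b = a * f ^+ 2 ->
  ip (L (xs - x m)) (xs - x m)
    <= 2 * ((f - 1) / (f + 1)) ^+ m * ip (L e) e.
Proof.
move=> f_ge1 bE.
have E_ge0 z : 0 <= ip (L z) z.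
  by rewrite (le_trans _ (L_ge z)) ?mulr_ge0 ?(ltW a_gt0).
have q_ge0 : 0 <= (f - 1) / (f + 1) by rewrite divr_ge0; lra.
have q_le1 : (f - 1) / (f + 1) <= 1 by rewrite ler_pdivrMr ?mul1r; lra.
case: m => [|k]; first by rewrite expr0 mulr1 ler_peMl // ler1n.
(* After termination the error has zero energy; otherwise all invariants are available. *)
have [rk0|rk0] := eqVneq (r k.+1) 0.
  rewrite -cg_residual_error rk0 -(scale0r 0) ipZl mul0r.
  by rewrite !mulr_ge0 ?exprn_ge0.
have [t_in _] := chebyshev_in_search (rS_neq0 rk0).
have [_ r_o _ _ _] := cg_invariants rk0.
move: t_in; set t := (chebyshev N G e k.+1).1; set T := (tau k.+1).1 => t_in.
have energy_le : ip (L t) t <= d ^+ (k.+1 + k.+1) * ip (L e) e.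
  pose u := (chebyshev N G e k.+1).2.
  have E : ip (L t) t + ip (L (G u)) u = d ^+ (k.+1 + k.+1) * ip (L e) e.
    apply: (@chebyshev_energy R V (fun y z => ip (L y) z))
      => [y z|s y|y z|y z w|s y z|y z].
    - by rewrite /N (linearD L); vector_field.
    - by rewrite /N (linearZ_LR L); vector_field.
    - by rewrite LC ipC.
    - by rewrite (linearD L) ipDl.
    - by rewrite (linearZ_LR L) ipZl.
    - by rewrite /N (linearB L) (linearZ_LR L) !ipE !LC.
  by rewrite -E lerDl chebyshev_weight_ge0.
(* Pythagoras for [ip (L y) z]: [t] is [T *: ek] plus a search vector, and [L ek] is the residual,
   orthogonal to that vector. *)
have opt : T ^+ 2 * ip (L (xs - x k.+1)) (xs - x k.+1) <= ip (L t) t.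
  set ek := xs - x k.+1; pose w := t - T *: ek.
  have w_in : w \in search k.+1.
    have -> : w = (t - T *: e) - T *: (x 0%N - x k.+1) by rewrite /w /ek /e; vector_field.
    by apply: rpredB => //; rewrite memvZ ?cg_error_in_search.
  have tE : t = T *: ek + w by rewrite /w addrC subrK.
  have Lew : ip (L ek) w = 0 by rewrite -cg_residual_error r_o.
  have Lwe : ip (L w) ek = 0 by rewrite LC ipC.
  rewrite tE; clearbody w ek.
  rewrite (linearD L) (linearZ_LR L) !ipE Lew Lwe.
  by rewrite !mulr0 !addr0 add0r mulrA -expr2 lerDl.
have s2 : c ^+ 2 - (a * f) ^+ 2 = d ^+ 2 by rewrite /c /d bE; field.
have s_ge0 : 0 <= a * f by rewrite mulr_ge0 ?(ltW a_gt0) //; lra.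
(* The scalar identity is taken at [s = a * f] and at [s = - (a * f)]. *)
have := chebyshev_scalar k.+1 s2; rewrite -(sqrrN (a * f)) in s2.
have := chebyshev_scalar k.+1 s2; rewrite -/(tau k.+1) -/T => tau_minus tau_plus.
have f1 : f + 1 != 0 by rewrite gt_eqF //; lra.
(* Here [c + a * f] and [c - a * f] are [a / 2] times the squares of [f + 1] and [f - 1], and [d] is
   their geometric mean. *)
have cs_minus : c - a * f = ((f - 1) / (f + 1)) ^+ 2 * (c + a * f).
  by rewrite /c bE; field.
have dE : d = (f - 1) / (f + 1) * (c + a * f) by rewrite /d /c bE; field.
have cs_gt0 : 0 < c + a * f.
  by rewrite ltr_wpDr // divr_gt0 ?ltr0n // addr_gt0 // (lt_le_trans a_gt0).
move: energy_le tau_minus tau_plus; rewrite exprD dE cs_minus.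
move: q_ge0 q_le1; set q := (f - 1) / (f + 1) => q_ge0 q_le1; clearbody q.
rewrite !exprMn /= -/T.
move=> energy_le; rewrite mulNr => tau_minus tau_plus.
apply: (chebyshev_ratio _ _ _ _ _ tau_minus tau_plus (le_trans opt energy_le)).
- exact: E_ge0.
- exact: E_ge0.
- by rewrite exprn_ge0.
- by rewrite exprn_ile1.
- by rewrite exprn_gt0.
Qed.
End SelfAdjoint.

(** * The tensor inner product and the quadratic form of the Sylvester operator *)

Section TensorForms.
Variables (R : realType) (M : nat) (J : 'I_M -> nat).
Implicit Types (X Y : tensor R J) (i : multi_index J).

Lemma inner_sym X Y : inner X Y = inner Y X.
Proof. by apply: eq_bigr => i _; rewrite mulrC. Qed.

Lemma innerDl X Y Z : inner (X + Y) Z = inner X Z + inner Y Z.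
Proof. by rewrite -big_split; apply: eq_bigr => i _; rewrite ffunE mulrDl. Qed.

Lemma innerZl a X Y : inner (a *: X) Y = a * inner X Y.
Proof. by rewrite mulr_sumr; apply: eq_bigr => i _; rewrite ffunE mulrA. Qed.

Lemma inner_gt0 X : X != 0 -> 0 < inner X X.
Proof.
move=> X0; have sq_ge0 i : true -> 0 <= (X i : R) * X i by rewrite -expr2 sqr_ge0.
rewrite lt_def sumr_ge0 // andbT; apply: contraNneq X0 => /eqP.
rewrite psumr_eq0 // => /allP Xi0; apply/eqP/ffunP => i; rewrite ffunE.
by have := Xi0 i; rewrite mem_index_enum mulf_eq0 orbb => /(_ isT)/eqP.
Qed.

Lemma mode_prod_is_linear k (B : 'M[R]_(J k)) :
  linear (fun X => mode_prod X B).
Proof.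
move=> a X Y; apply/ffunP => i; rewrite !ffunE /= scaler_sumr -big_split /=.
by apply: eq_bigr => l _; rewrite !ffunE mulrDl -[a *: _]/(a * _) -[a *: _]/(a * _) mulrA.
Qed.

Lemma sylvester_op_is_linear (A : forall k, 'M[R]_(J k)) : linear (sylvester_op A).
Proof.
move=> a X Y; rewrite /sylvester_op scaler_sumr -big_split /=.
by apply: eq_bigr => k _; rewrite mode_prod_is_linear.
Qed.

HB.instance Definition _ (A : forall k, 'M[R]_(J k)) :=
  GRing.isLinear.Build R (tensor R J) (tensor R J) *:%R (sylvester_op A)
    (sylvester_op_is_linear A).

Section OneMode.
Variable k : 'I_M.
Implicit Type B : 'M[R]_(J k).

Let upd i (l : 'I_(J k)) : multi_index J := finfun (dfwith i l).

Let upd_at i l : upd i l k = l.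
Proof. by rewrite ffunE dfwith_in. Qed.

Let upd_upd i l l' : upd (upd i l) l' = upd i l'.
Proof.
apply/ffunP => j; rewrite !ffunE; have [<-|kj] := eqVneq k j.
  by rewrite !dfwith_in.
by rewrite !dfwith_out // ffunE dfwith_out.
Qed.

Let upd_id i : upd i (i k) = i.
Proof.
apply/ffunP => j; rewrite !ffunE; have [<-|kj] := eqVneq k j.
  by rewrite !dfwith_in.
by rewrite !dfwith_out.
Qed.

(** Exchanging the [k]-th coordinate of [i] with the free index [l] is an involution on pairs. *)
Let sum_upd_swap (F : multi_index J -> 'I_(J k) -> R) :
  \sum_i \sum_l F i l = \sum_i \sum_l F (upd i l) (i k).
Proof.
pose swap (q : multi_index J * 'I_(J k)) := (upd q.1 q.2, q.1 k).
have swapK : involutive swap by move=> [i l]; rewrite /swap /= upd_upd upd_at upd_id.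
by rewrite !pair_bigA (reindex_inj (inv_inj swapK)).
Qed.

Let sum_upd (f : multi_index J -> R) :
  \sum_i \sum_l f (upd i l) = (J k)%:R * \sum_i f i.
Proof.
rewrite (sum_upd_swap (fun i l => f (upd i l))) mulr_sumr; apply: eq_bigr => i _.
rewrite (eq_bigr (fun=> f i)) => [|l _]; last by rewrite upd_upd upd_id.
by rewrite sumr_const card_ord mulr_natl.
Qed.

Lemma mode_prod_sym B X Y : B^T = B ->
  inner (mode_prod X B) Y = inner X (mode_prod Y B).
Proof.
move=> Bsym; rewrite /inner.
transitivity (\sum_i \sum_(l < J k) (X (upd i l) : R) * B (i k) l * (Y i : R)).
  by apply: eq_bigr => i _; rewrite ffunE mulr_suml.
rewrite sum_upd_swap; apply: eq_bigr => i _; rewrite ffunE mulr_sumr.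
by apply: eq_bigr => l _; rewrite upd_at upd_upd upd_id -[in LHS]Bsym mxE mulrAC mulrA.
Qed.

(* Over all multi-indices i, every mode-k fibre of X occurs J_k times. *)
Let fibre X i : 'cV[R]_(J k) := \col_l X (upd i l).

Let inner_fibre X : (J k)%:R * inner X X = \sum_i ((fibre X i)^T *m fibre X i) 0 0.
Proof.
rewrite -sum_upd; apply: eq_bigr => i _.
by rewrite mxE; apply: eq_bigr => l _; rewrite !mxE.
Qed.

(** The mode product sums over the column index of [B], so a fibre written as a row is multiplied by
    [B^T] on the right. *)
Let mode_prod_fibre B X :
  (J k)%:R * inner (mode_prod X B) X = \sum_i ((fibre X i)^T *m B^T *m fibre X i) 0 0.
Proof.
rewrite -sum_upd; apply: eq_bigr => i _.
rewrite mxE; apply: eq_bigr => l _; rewrite !mxE !ffunE; congr (_ * _).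
by apply: eq_bigr => l' _; rewrite !mxE dfwith_in -/(upd _ _) upd_upd.
Qed.

(** The matrix inequality is summed over all fibres; as [J k] is positive, their common multiplicity
    cancels. *)
Lemma mode_prod_ge (a : R) B X : (0 < J k)%N -> B^T = B ->
  (forall x : 'cV_(J k), a * (x^T *m x) 0 0 <= (x^T *m B *m x) 0 0) ->
  a * inner X X <= inner (mode_prod X B) X.
Proof.
move=> Jk Bsym a_le; rewrite -(ler_pM2l (_ : 0 < (J k)%:R)) ?ltr0n // mulrCA.
rewrite inner_fibre mode_prod_fibre Bsym mulr_sumr.
by apply: ler_sum => i _.
Qed.

Lemma mode_prod_le (b : R) B X : (0 < J k)%N -> B^T = B ->
  (forall x : 'cV_(J k), (x^T *m B *m x) 0 0 <= b * (x^T *m x) 0 0) ->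
  inner (mode_prod X B) X <= b * inner X X.
Proof.
move=> Jk Bsym b_ge; rewrite -(ler_pM2l (_ : 0 < (J k)%:R)) ?ltr0n // [leRHS]mulrCA.
rewrite inner_fibre mode_prod_fibre Bsym mulr_sumr.
by apply: ler_sum => i _.
Qed.
End OneMode.

Lemma inner_suml (I : finType) (F : I -> tensor R J) Y :
  inner (\sum_j F j) Y = \sum_j inner (F j) Y.
Proof.
elim/big_rec2: _ => [|j y z _ <-]; last by rewrite innerDl.
by rewrite -(scale0r 0) innerZl mul0r.
Qed.

Variable A : forall k, 'M[R]_(J k).
Hypothesis Asym : forall k, (A k)^T = A k.

Lemma sylvester_op_sym X Y : inner (sylvester_op A X) Y = inner X (sylvester_op A Y).
Proof.
rewrite [RHS]inner_sym !inner_suml; apply: eq_bigr => k _.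
by rewrite mode_prod_sym // inner_sym.
Qed.

Hypothesis J_gt0 : forall k, (0 < J k)%N.

Lemma sylvester_op_ge (a : 'I_M -> R) X :
  (forall k (x : 'cV_(J k)), a k * (x^T *m x) 0 0 <= (x^T *m A k *m x) 0 0) ->
  (\sum_k a k) * inner X X <= inner (sylvester_op A X) X.
Proof.
by move=> a_le; rewrite inner_suml mulr_suml ler_sum // => k _; apply: mode_prod_ge.
Qed.

Lemma sylvester_op_le (b : 'I_M -> R) X :
  (forall k (x : 'cV_(J k)), (x^T *m A k *m x) 0 0 <= b k * (x^T *m x) 0 0) ->
  inner (sylvester_op A X) X <= (\sum_k b k) * inner X X.
Proof.
by move=> b_ge; rewrite inner_suml mulr_suml ler_sum // => k _; apply: mode_prod_le.
Qed.

End TensorForms.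

(** * Rayleigh bounds for real symmetric matrices *)

Section SymmetricMatrices.
Variable R : realType.

Lemma trmx_mul_self_gt0 n (x : 'cV[R]_n) : x != 0 -> 0 < (x^T *m x) 0 0.
Proof.
move=> x0; have sq_ge0 i : true -> 0 <= x^T 0 i * x i 0 by rewrite mxE -expr2 sqr_ge0.
rewrite mxE lt_def sumr_ge0 // andbT; apply: contraNneq x0 => /eqP.
rewrite psumr_eq0 // => /allP xi0; apply/eqP/colP => i; rewrite mxE.
by have := xi0 i; rewrite mem_index_enum mxE mulf_eq0 orbb => /(_ isT)/eqP.
Qed.

Local Open Scope sesquilinear_scope.
(** Over the complex numbers [B] is unitarily diagonalisable; in the coordinates [y = P x] both
    forms are sums of squared moduli, compared term by term. *)
Lemma form_ge_eigenvalue n (B : 'M[R]_n) (a : R) (x : 'cV_n) : B^T = B ->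
  (forall t, eigenvalue B t -> a <= t) ->
  a * (x^T *m x) 0 0 <= (x^T *m B *m x) 0 0.
Proof.
move=> Bsym a_le; pose BC := map_mx (real_complex R) B.
have mapJ m p (Y : 'M[R]_(m, p)) :
    map_mx Num.Def.conjC (map_mx (real_complex R) Y) = map_mx (real_complex R) Y.
  apply/matrixP => i j; rewrite !mxE; apply/CrealP.
  by apply/complex_realP; exists (Y i j).
have BC_herm : BC \is hermsymmx.
  have tBC : BC^T = BC by rewrite /BC map_trmx Bsym.
  by apply/is_hermitianmxP; rewrite expr0 scale1r tBC mapJ.
have /orthomx_spectralP := hermitian_normalmx BC_herm.
have := hermitian_spectral_diag_real BC_herm.
have := spectral_unitarymx BC; have := spectral_unit BC.
move: (spectralmx BC) (spectral_diag BC) => P D Punit Punitary Dreal BCE.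
have invP := invmx_unitary Punitary.
(* The diagonal entries are real, and the rows of [P] are eigenvectors for them, so they are
   eigenvalues of the real matrix [B]. *)
have aD i : (real_complex R a) <= D 0 i.
  have /complex_realP[t Dt] : D 0 i \is Num.real by move/mxOverP: Dreal; apply.
  suff: eigenvalue BC (D 0 i).
    by rewrite Dt lecR => Beig; apply: a_le; rewrite -(eigenvalue_map (real_complex R)).
  apply/eigenvalueP; exists (row i P).
    rewrite {1}BCE -!mulmxA -row_mul mulKVmx //.
    by apply/rowP => j; rewrite mul_diag_mx !mxE.
  (* A zero row would make the determinant of the invertible matrix [P] vanish. *)
  apply: contraTneq Punit => Pi0.
  rewrite unitmxE (expand_det_row P i) big1 ?unitr0 // => j _.
  by have /rowP/(_ j) := Pi0; rewrite !mxE => ->; rewrite mul0r.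
rewrite -lecR rmorphM /=.
have mapE (Y : 'M[R]_1) : (real_complex R) (Y 0 0) = (map_mx (real_complex R) Y) 0 0.
  by rewrite mxE.
rewrite !mapE !map_mxM /= -/BC -!map_trmx; set xC := map_mx _ x.
have xCJ : xC^T = xC^t* by rewrite map_trmx mapJ.
have -> : xC^T *m BC *m xC = (P *m xC)^t* *m diag_mx D *m (P *m xC).
  by rewrite BCE invP trmx_mul map_mxM -xCJ !mulmxA.
have -> : xC^T *m xC = (P *m xC)^t* *m (P *m xC).
  by rewrite trmx_mul map_mxM -xCJ -invP -mulmxA mulKmx.
move: (P *m xC) => y; rewrite mxE mulr_sumr -mulmxA mul_diag_mx mxE.
apply: ler_sum => i _; rewrite !mxE [leRHS]mulrCA ler_wpM2r ?aD //.
by rewrite mulrC -normCK exprn_ge0.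
Qed.

Lemma form_le_eigenvalue n (B : 'M[R]_n) (b : R) (x : 'cV_n) : B^T = B ->
  (forall t, eigenvalue B t -> t <= b) ->
  (x^T *m B *m x) 0 0 <= b * (x^T *m x) 0 0.
Proof.
move=> Bsym b_ge; have := @form_ge_eigenvalue _ (- B) (- b) x.
rewrite mulmxN mulNmx !mxE mulNr lerN2; apply=> [|t /eigenvalueP[v vB v0]].
  by rewrite linearN /= Bsym.
rewrite lerNl b_ge //; apply/eigenvalueP; exists v => //.
by rewrite scaleNr -vB mulmxN opprK.
Qed.

Lemma eigenvalue_rayleigh n (B : 'M[R]_n) (t : R) : eigenvalue B t ->
  exists2 x : 'cV_n, x != 0 & (x^T *m B *m x) 0 0 = t * (x^T *m x) 0 0.
Proof.
case/eigenvalueP => v vB v0; exists v^T; first by rewrite trmx_eq0.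
by rewrite trmxK vB -scalemxAl mxE.
Qed.

End SymmetricMatrices.

(** * Quadratic form and eigenvalues of the Kronecker sum *)

Section KroneckerSum.
Variable R : realType.

Lemma sum_mxtens_index m n (F : 'I_(m * n) -> R) :
  \sum_p F p = \sum_i \sum_j F (mxtens_index (i, j)).
Proof.
rewrite pair_bigA /= (reindex (@mxtens_index m n)) /=; last first.
  by exists (@mxtens_unindex m n) => p _; rewrite (mxtens_indexK, mxtens_unindexK).
by apply: eq_bigr => -[].
Qed.

(** With [x] read as an [m] by [n] matrix, these are its columns and rows; [A *t 1%:M] acts on each
    column and [1%:M *t B] on each row. *)
Let colslice m n (x : 'cV[R]_(m * n)) j : 'cV_m := \col_i x (mxtens_index (i, j)) 0.
Let rowslice m n (x : 'cV[R]_(m * n)) i : 'cV_n := \col_j x (mxtens_index (i, j)) 0.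

Lemma form_tensmx1 m n (A : 'M[R]_m) (x : 'cV_(m * n)) :
  (x^T *m (A *t (1%:M : 'M_n)) *m x) 0 0
    = \sum_j ((colslice x j)^T *m A *m colslice x j) 0 0.
Proof.
rewrite mxE sum_mxtens_index exchange_big; apply: eq_bigr => j _.
rewrite mxE; apply: eq_bigr => i _; rewrite !mxE; congr (_ * _).
rewrite sum_mxtens_index; apply: eq_bigr => k _.
rewrite (bigD1 j) //= big1 ?addr0 => [|l lj]; rewrite tensmxE !mxE ?eqxx ?mulr1 //.
by rewrite (negPf lj) !mulr0.
Qed.

Lemma form_1tensmx m n (B : 'M[R]_n) (x : 'cV_(m * n)) :
  (x^T *m ((1%:M : 'M_m) *t B) *m x) 0 0
    = \sum_i ((rowslice x i)^T *m B *m rowslice x i) 0 0.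
Proof.
rewrite mxE sum_mxtens_index; apply: eq_bigr => i _.
rewrite mxE; apply: eq_bigr => j _; rewrite !mxE; congr (_ * _).
rewrite sum_mxtens_index exchange_big; apply: eq_bigr => k _ /=.
rewrite (bigD1 i) //= big1 ?addr0 => [|l li]; rewrite tensmxE !mxE ?eqxx ?mul1r //.
by rewrite (negPf li) mul0r mulr0.
Qed.

Lemma dot_colslice m n (x : 'cV[R]_(m * n)) :
  (x^T *m x) 0 0 = \sum_j ((colslice x j)^T *m colslice x j) 0 0.
Proof.
rewrite mxE sum_mxtens_index exchange_big; apply: eq_bigr => j _.
by rewrite mxE; apply: eq_bigr => i _; rewrite !mxE.
Qed.

Lemma dot_rowslice m n (x : 'cV[R]_(m * n)) :
  (x^T *m x) 0 0 = \sum_i ((rowslice x i)^T *m rowslice x i) 0 0.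
Proof.
rewrite mxE sum_mxtens_index; apply: eq_bigr => i _.
by rewrite mxE; apply: eq_bigr => j _; rewrite !mxE.
Qed.

Lemma form_tensD m n (A : 'M[R]_m) (B : 'M[R]_n) (x : 'cV_(m * n)) :
  (x^T *m (A *t 1%:M + 1%:M *t B) *m x) 0 0
    = \sum_j ((colslice x j)^T *m A *m colslice x j) 0 0
    + \sum_i ((rowslice x i)^T *m B *m rowslice x i) 0 0.
Proof. by rewrite mulmxDr mulmxDl mxE form_tensmx1 form_1tensmx. Qed.

(** The order [b + a] matches [big_ord_recr], which puts the last mode, the left tensor factor, at
    the end of the sum. *)
Lemma tensD_form_ge m n (A : 'M[R]_m) (B : 'M[R]_n) (a b : R) :
    (forall x : 'cV_m, a * (x^T *m x) 0 0 <= (x^T *m A *m x) 0 0) ->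
    (forall x : 'cV_n, b * (x^T *m x) 0 0 <= (x^T *m B *m x) 0 0) ->
  forall x : 'cV_(m * n),
    (b + a) * (x^T *m x) 0 0 <= (x^T *m (A *t 1%:M + 1%:M *t B) *m x) 0 0.
Proof.
move=> a_le b_le x; rewrite form_tensD addrC mulrDl [X in b * X]dot_rowslice dot_colslice.
by rewrite !mulr_sumr lerD ?ler_sum.
Qed.

Lemma tensD_form_le m n (A : 'M[R]_m) (B : 'M[R]_n) (a b : R) :
    (forall x : 'cV_m, (x^T *m A *m x) 0 0 <= a * (x^T *m x) 0 0) ->
    (forall x : 'cV_n, (x^T *m B *m x) 0 0 <= b * (x^T *m x) 0 0) ->
  forall x : 'cV_(m * n),
    (x^T *m (A *t 1%:M + 1%:M *t B) *m x) 0 0 <= (b + a) * (x^T *m x) 0 0.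
Proof.
move=> a_ge b_ge x; rewrite form_tensD addrC mulrDl [X in b * X]dot_rowslice dot_colslice.
by rewrite !mulr_sumr lerD ?ler_sum.
Qed.

Lemma tensD_eigenvalue m n (A : 'M[R]_m) (B : 'M[R]_n) (a b : R) :
  eigenvalue A a -> eigenvalue B b -> eigenvalue (A *t 1%:M + 1%:M *t B) (b + a).
Proof.
move=> /eigenvalueP[v vA v0] /eigenvalueP[w wB w0].
have vw : (v *t w) *m (A *t 1%:M + 1%:M *t B) = (b + a) *: (v *t w).
  rewrite mulmxDr !tensmx_mul !mulmx1 vA wB.
  by apply/matrixP => i j; rewrite !mxE; ring.
apply/eigenvalueP; exists (v *t w); first exact: vw.
have /rV0Pn[i vi] := v0; have /rV0Pn[j wj] := w0.
apply/eqP => vw0; have := tensmxE v w 0 0 i j.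
have -> : v *t w = 0 by exact: vw0.
by rewrite mxE => /esym/eqP; rewrite mulf_eq0 (negPf vi) (negPf wj).
Qed.

Lemma eq_kron_prod M (J : 'I_M -> nat) (B C : forall k, 'M[R]_(J k)) :
  (forall k, B k = C k) -> kron_prod B = kron_prod C.
Proof.
elim: M J B C => //= M IHM J B C BC.
by rewrite BC (IHM _ _ (fun k => C (widen_ord (leqnSn M) k))).
Qed.

Lemma kron_prod1 M (J : 'I_M -> nat) :
  kron_prod (fun k => 1%:M : 'M[R]_(J k)) = 1%:M.
Proof.
elim: M J => //= M IHM J; rewrite IHM; apply/matrixP => p q.
case: (mxtens_indexP p) => i j; case: (mxtens_indexP q) => k l.
rewrite tensmxE !mxE (inj_eq (can_inj (@mxtens_indexK _ _))) xpair_eqE.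
by rewrite -natrM mulnb.
Qed.

(** Splitting off the last mode reduces every property of the Kronecker sum to the case of two
    factors, by induction on [M]. *)
Lemma kron_sumS M (J : 'I_M.+1 -> nat) (A : forall k, 'M[R]_(J k)) :
  kron_sum A = A ord_max *t 1%:M
             + 1%:M *t kron_sum (fun k => A (widen_ord (leqnSn M) k)).
Proof.
have widen_neq k : widen_ord (leqnSn M) k != ord_max.
  by rewrite -val_eqE /= ltn_eqF.
rewrite /kron_sum big_ord_recr [RHS]addrC; congr (_ + _) => /=; last first.
  rewrite dfwith_in -[in RHS]kron_prod1; congr (_ *t _).
  by apply: eq_kron_prod => k; rewrite dfwith_out // eq_sym.
have tens_sumr (F : 'I_M -> 'M[R]_(kron_dim (fun k => J (widen_ord (leqnSn M) k)))) :
    (1%:M : 'M_(J ord_max)) *t (\sum_k F k) = \sum_k 1%:M *t F k.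
  apply/matrixP => p q; rewrite summxE mxE summxE mulr_sumr.
  by apply: eq_bigr => k _; rewrite [RHS]mxE.
rewrite tens_sumr; apply: eq_bigr => k _; rewrite dfwith_out; last exact: widen_neq.
congr (_ *t _); apply: eq_kron_prod => j; have [<-|kj] := eqVneq k j.
  by rewrite !dfwith_in.
rewrite !dfwith_out // -val_eqE /=; exact: kj.
Qed.

Lemma kron_sum_sym M (J : 'I_M -> nat) (A : forall k, 'M[R]_(J k)) :
  (forall k, (A k)^T = A k) -> (kron_sum A)^T = kron_sum A.
Proof.
elim: M J A => [|M IHM] J A Asym; first by rewrite /kron_sum big_ord0 linear0.
by rewrite kron_sumS linearD /= !trmx_tens !trmx1 Asym IHM.
Qed.

Lemma kron_sum_form_ge M (J : 'I_M -> nat) (A : forall k, 'M[R]_(J k)) (a : 'I_M -> R) :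
    (forall k (x : 'cV_(J k)), a k * (x^T *m x) 0 0 <= (x^T *m A k *m x) 0 0) ->
  forall x : 'cV_(kron_dim J),
    (\sum_k a k) * (x^T *m x) 0 0 <= (x^T *m kron_sum A *m x) 0 0.
Proof.
elim: M J A a => [|M IHM] J A a a_le x.
  by rewrite /kron_sum !big_ord0 mul0r mulmx0 mul0mx mxE.
by rewrite kron_sumS big_ord_recr; apply: tensD_form_ge => //; apply: IHM.
Qed.

Lemma kron_sum_form_le M (J : 'I_M -> nat) (A : forall k, 'M[R]_(J k)) (b : 'I_M -> R) :
    (forall k (x : 'cV_(J k)), (x^T *m A k *m x) 0 0 <= b k * (x^T *m x) 0 0) ->
  forall x : 'cV_(kron_dim J),
    (x^T *m kron_sum A *m x) 0 0 <= (\sum_k b k) * (x^T *m x) 0 0.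
Proof.
elim: M J A b => [|M IHM] J A b b_ge x.
  by rewrite /kron_sum !big_ord0 mul0r mulmx0 mul0mx mxE.
by rewrite kron_sumS big_ord_recr; apply: tensD_form_le => //; apply: IHM.
Qed.

Lemma kron_sum_eigenvalue M (J : 'I_M -> nat) (A : forall k, 'M[R]_(J k)) (a : 'I_M -> R) :
  (forall k, eigenvalue (A k) (a k)) -> eigenvalue (kron_sum A) (\sum_k a k).
Proof.
elim: M J A a => [|M IHM] J A a eig.
  (* With no modes the Kronecker sum is the 1 by 1 zero matrix, with eigenvalue 0. *)
  rewrite /kron_sum !big_ord0; apply/eigenvalueP; exists (const_mx 1).
    by rewrite mulmx0 scale0r.
  by apply/rV0Pn; exists 0; rewrite mxE oner_eq0.
by rewrite kron_sumS big_ord_recr; apply: tensD_eigenvalue => //; apply: IHM.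
Qed.
End KroneckerSum.

(** * The tensor iteration as an instance of the abstract conjugate gradient method *)

Section TensorConjugateGradient.
Variables (R : realType) (M : nat) (J : 'I_M -> nat).
Variables (A : forall k, 'M[R]_(J k)) (D Xs X0 : tensor R J).
Hypothesis XsE : sylvester_op A Xs = D.

Let st j := iter j (cg_step A) (cg_init A D X0).
Let x j := cg_iterate (st j).
Let r j := cg_residual (st j).
Let p j := cg_direction (st j).

Let stS j : r j != 0 ->
  [/\ x j.+1 = x j + (inner (r j) (r j) / inner (sylvester_op A (p j)) (p j)) *: p j,
      r j.+1 = r j - (inner (r j) (r j) / inner (sylvester_op A (p j)) (p j))
                       *: sylvester_op A (p j)
    & p j.+1 = r j.+1 + (inner (r j.+1) (r j.+1) / inner (r j) (r j)) *: p j].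
Proof.
rewrite /x /r /p /st iterS; case: (iter j _ _) => X r' P /= /negPf rj0.
by rewrite rj0.
Qed.

Let st_stop j : r j = 0 -> st j.+1 = st j.
Proof.
by rewrite /r /st iterS; case: (iter j _ _) => X r' P /= ->; rewrite eqxx.
Qed.

Lemma cg_btf_error_le (a b f : R) m :
    (forall X Y, inner (sylvester_op A X) Y = inner X (sylvester_op A Y)) ->
    0 < a -> a <= b ->
    (forall X, a * inner X X <= inner (sylvester_op A X) X) ->
    (forall X, inner (sylvester_op A X) X <= b * inner X X) ->
    1 <= f -> b = a * f ^+ 2 ->
  op_inner A (Xs - cg_btf A D X0 m) (Xs - cg_btf A D X0 m)
    <= 2 * ((f - 1) / (f + 1)) ^+ m * op_inner A (Xs - X0) (Xs - X0).
Proof.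
move=> Lsym a_gt0 le_ab L_ge L_le f_ge1 bE.
apply: (@cg_error_le R (tensor R J) (@inner R M J) (@inner_sym _ _ _)
  (@innerDl _ _ _) (@innerZl _ _ _) (@inner_gt0 _ _ _) (sylvester_op A) a b
  Lsym a_gt0 le_ab L_ge L_le x r p Xs) => // [|j /stS[]|j /stS[]|j /stS[]|j rj0|j rj0] //.
- by rewrite /r /x /= (linearB (sylvester_op A)) /= XsE.
- by rewrite /x st_stop.
- by rewrite /r st_stop.
Qed.
End TensorConjugateGradient.

Theorem theorem3p2p1 (R : realType) (M : nat) (J : 'I_M -> nat)
    (A : forall k : 'I_M, 'M[R]_(J k)) (lmax lmin : 'I_M -> R)
    (hM : (1 <= M)%N) (hJ : forall k : 'I_M, (1 <= J k)%N)
    (hsym : forall k : 'I_M, (A k)^T = A k)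
    (hpos : forall k : 'I_M, posdefmx (A k))
    (hmax : forall k : 'I_M, is_max_eigenvalue (A k) (lmax k))
    (hmin : forall k : 'I_M, is_min_eigenvalue (A k) (lmin k)) :
  let Lmax : R := \sum_(k < M) lmax k in
  let Lmin : R := \sum_(k < M) lmin k in
  let kappa : R := Lmax / Lmin in
  [/\ (kron_sum A)^T = kron_sum A,
      posdefmx (kron_sum A),
      is_max_eigenvalue (kron_sum A) Lmax
    & is_min_eigenvalue (kron_sum A) Lmin]
  /\ (forall D Xs X0 : tensor R J,
        sylvester_op A Xs = D ->
        X0 <> Xs ->
        forall m : nat,
          op_norm A (cg_btf A D X0 m - Xs) ^+ 2 / op_norm A (X0 - Xs) ^+ 2
            <= 2 * ((Num.sqrt kappa - 1) / (Num.sqrt kappa + 1)) ^+ m).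
Proof.
move=> Lmax Lmin kappa.
have A_ge k (x : 'cV_(J k)) : lmin k * (x^T *m x) 0 0 <= (x^T *m A k *m x) 0 0.
  by apply: form_ge_eigenvalue => //; have [] := hmin k.
have A_le k (x : 'cV_(J k)) : (x^T *m A k *m x) 0 0 <= lmax k * (x^T *m x) 0 0.
  by apply: form_le_eigenvalue => //; have [] := hmax k.
(* Positive definiteness is tested on an eigenvector for [lmin k]. *)
have lmin_gt0 k : 0 < lmin k.
  have [/eigenvalue_rayleigh[x x0 xE] _] := hmin k.
  by have := hpos k x x0; rewrite xE pmulr_lgt0 // trmx_mul_self_gt0.
have lmin_le k : lmin k <= lmax k by have [_ ->] := hmax k; have [] := hmin k.
have Lmin_gt0 : 0 < Lmin.
  (* As [M] is at least 1, the sum has a term, hence is strictly positive. *)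
  rewrite /Lmin (bigD1 (Ordinal hM)) //= ltr_wpDr ?sumr_ge0 // => k _.
  exact: ltW.
have Lmin_le : Lmin <= Lmax by apply: ler_sum.
have K_ge := kron_sum_form_ge A_ge; have K_le := kron_sum_form_le A_le.
split.
  split.
  - exact: kron_sum_sym.
  - by move=> x x0; apply: lt_le_trans (K_ge x); rewrite mulr_gt0 ?trmx_mul_self_gt0.
  - split; first by apply: kron_sum_eigenvalue => k; have [] := hmax k.
    move=> t /eigenvalue_rayleigh[x x0 xE]; have := K_le x.
    by rewrite xE ler_pM2r ?trmx_mul_self_gt0.
  - split; first by apply: kron_sum_eigenvalue => k; have [] := hmin k.
    move=> t /eigenvalue_rayleigh[x x0 xE]; have := K_ge x.
    by rewrite xE ler_pM2r ?trmx_mul_self_gt0.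
move=> D Xs X0 XsE X0s m.
have L_ge X := sylvester_op_ge hsym hJ X A_ge.
have L_le X := sylvester_op_le hsym hJ X A_le.
have op_ge0 X : 0 <= op_inner A X X.
  have [->|X_neq0] := eqVneq X 0.
    by rewrite /op_inner inner_sym -(scale0r 0) innerZl mul0r.
  by rewrite (le_trans _ (L_ge X)) // mulr_ge0 ?ltW ?inner_gt0.
have op_gt0 X : X != 0 -> 0 < op_inner A X X.
  by move=> X_neq0; rewrite (lt_le_trans _ (L_ge X)) // mulr_gt0 ?inner_gt0.
have op_sub X Y : op_inner A (X - Y) (X - Y) = op_inner A (Y - X) (Y - X).
  rewrite -(opprB Y X) /op_inner (linearN (sylvester_op A)) -!scaleN1r innerZl.
  by rewrite inner_sym innerZl inner_sym mulrA mulrNN !mul1r.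
have kappa_ge1 : 1 <= kappa by rewrite ler_pdivlMr ?mul1r.
(* [Num.sqrt] is 0 on negative numbers, so [op_ge0] is what makes the squared norms equal to the
   energies. *)
rewrite /op_norm !sqr_sqrtr // ler_pdivrMr; last first.
  by apply: op_gt0; rewrite subr_eq0; apply/eqP.
rewrite op_sub (op_sub X0).
apply: (cg_btf_error_le X0 XsE m (sylvester_op_sym hsym) Lmin_gt0 Lmin_le L_ge L_le).
  by rewrite -[leLHS]sqrtr1 ler_wsqrtr.
rewrite sqr_sqrtr ?(le_trans ler01) // /kappa mulrC divfK //.
by rewrite gt_eqF.
Qed.
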